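(* Let $(\mathcal F_0,\mathbf a)$ be initial data for the completion problem in $\mathbb C^d$ with $\mathbf a=\mathbf a^\downarrow\in\mathbb R_{>0}^k$ and $k\ge d$, let $\lambda=\lambda^\uparrow(S_{\mathcal F_0})$, let $f:[0,\infty)\to[0,\infty)$ be strictly convex, and write $$\nu_f(\lambda,\mathbf a)=\big(c_1\mathbf 1_{s_1},c_2\mathbf 1_{s_2-s_1},\dots,c_p\mathbf 1_{s_p-s_{p-1}},\lambda_{s_p+1},\dots,\lambda_d\big)$$ with $p$, $c_1>\dots>c_p>0$ and $0=s_0<s_1<\dots<s_p\le d$ as described in the context. For $1\le j\le r\le d$ let $P_{j,r}=\frac1{r-j+1}\sum_{i=j}^r(\lambda_i+a_i)$. Then: 1. The index $s_{p-1}$ (where the feasible part begins) is $s_{p-1}=\min\{s\in\{0,1,\dots,d-1\}: s\text{ is feasible}\}$. 2. If $p>1$, the following recursive method describes the remaining indexes and constants: (a) $s_1=\max\{j\le s_{p-1}:P_{1,j}=\max_{1\le i\le s_{p-1}}P_{1,i}\}$ and $c_1=P_{1,s_1}$. (b) If $s_j$ is already computed and $s_j<s_{p-1}$, then $$s_{j+1}=\max\Big\{s_j<r\le s_{p-1}: P_{s_j+1,r}=\max_{s_j<i\le s_{p-1}}P_{s_j+1,i}\Big\}\quad\text{and}\quad c_{j+1}=P_{s_j+1,s_{j+1}}.$$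
   Context: Notation. $\mathbf 1_m\in\mathbb R^m$ is the all-ones vector; $\operatorname{tr}x=\sum_i x_i$; $x^\downarrow$ (resp. $x^\uparrow$) is the rearrangement of $x$ in decreasing (resp. increasing, i.e. non-decreasing) order. For $x,y\in\mathbb R^m$, $x\prec y$ means $\sum_{i\le j}x_i^\downarrow\le\sum_{i\le j}y_i^\downarrow$ for all $j$ and $\operatorname{tr}x=\operatorname{tr}y$; for vectors of different sizes (non-negative entries) complete with zeros. For a finite sequence $\mathcal F=\{f_i\}$ in $\mathcal H=\mathbb C^d$, $S_{\mathcal F}=\sum_i f_i\otimes f_i$ is its frame operator, where $(x\otimes y)(z)=\langle z,y\rangle x$. For positive semidefinite $S$, $\lambda(S)=\lambda^\downarrow(S)$ (resp. $\lambda^\uparrow(S)$) is the vector of its eigenvalues with multiplicity in decreasing (resp. increasing) order. Initial data for the completion problem: a finite sequence $\mathcal F_0=\{f_i\}_{i=1}^{n_0}$ in $\mathcal H$ and $\mathbf a=(a_i)_{i=1}^k\in\mathbb R_{>0}^k$ with $a_1\ge\dots\ge a_k$ and $d-\operatorname{rk}S_{\mathcal F_0}\le k$. $\mathcal C_{\mathbf a}(\mathcal F_0)=\{(\mathcal F_0,\mathcal G):\mathcal G=\{g_i\}_{i=1}^k\subset\mathcal H,\ \|g_i\|^2=a_i\}$. For strictly convex $f:[0,\infty)\to[0,\infty)$, $P_f(\mathcal F)=\sum_{i=1}^d f(\lambda_i(S_{\mathcal F}))$. Let $\Gamma_d(\mathbf a)=\{\gamma\in\mathbb R_{\ge0}^d:\gamma=\gamma^\downarrow,\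 \mathbf a\prec\gamma\}$. There is a unique $\mu=\mu_f(\lambda,\mathbf a)\in\Gamma_d(\mathbf a)$ minimizing $\gamma\mapsto\sum_{i=1}^d f(\lambda_i+\gamma_i)$ on $\Gamma_d(\mathbf a)$; set $\nu_f(\lambda,\mathbf a)=\lambda+\mu_f(\lambda,\mathbf a)$. (A completion $\mathcal F=(\mathcal F_0,\mathcal G)$ is a global minimizer of $P_f$ on $\mathcal C_{\mathbf a}(\mathcal F_0)$ iff $\lambda(S_{\mathcal G})=\mu_f(\lambda,\mathbf a)$ and $\lambda(S_{\mathcal F})=\nu_f(\lambda,\mathbf a)^\downarrow$.) Let $s_p=\max\{i:\mu_i\neq0\}$, let $c_1>\dots>c_p>0$ be the distinct values of $\lambda_i+\mu_i$ for $1\le i\le s_p$, and $K_j=\{i\le s_p:\lambda_i+\mu_i=c_j\}$. The sets $K_j$ are consecutive intervals $K_j=\{s_{j-1}+1,\dots,s_j\}$ with $0=s_0<s_1<\dots<s_p$, which defines the $s_j$. Feasibility (for $k\ge d$). For $\lambda=\lambda^\uparrow\in\mathbb R_{\ge0}^d$, $\mathbf a=\mathbf a^\downarrow\in\mathbb R_{>0}^k$, $t=\operatorname{tr}\lambda+\operatorname{tr}\mathbf a$, define $\nu(\lambda,\mathbf a)=\frac td\mathbf 1_d$ if $\lambda_d\le\frac td$; otherwise $\nu(\lambda,\mathbf a)=(c\mathbf 1_s,\lambda_{s+1},\dots,\lambda_d)$ where $s\in\{1,\dots,d-1\}$ is the unique index such that $c=\frac1s[\operatorname{tr}\mathbf a+\sum_{i=1}^s\lambda_i]$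 satisfies $\lambda_s\le c<\lambda_{s+1}$. The pair $(\lambda,\mathbf a)$ is feasible if $\mathbf a\prec\nu(\lambda,\mathbf a)-\lambda$. An index $s\in\{0,1,\dots,d-1\}$ is feasible if the truncated pair $(\lambda^s,\mathbf a^s)$, $\lambda^s=(\lambda_{s+1},\dots,\lambda_d)\in\mathbb R^{d-s}$, $\mathbf a^s=(a_{s+1},\dots,a_k)\in\mathbb R^{k-s}$, is feasible in this sense (for $s=0$: the pair $(\lambda,\mathbf a)$ itself). *)

(* Defs.v *)
From HB Require Import structures.
From mathcomp Require Import all_boot all_order all_algebra.
From mathcomp Require Import spectral.
From mathcomp Require Import complex.
From mathcomp Require Import reals.

Set Implicit Arguments.
Unset Strict Implicit.
Unset Printing Implicit Defensive.

Import Order.TTheory GRing.Theory Num.Theory.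
Local Open Scope ring_scope.
Local Open Scope complex_scope.
Local Open Scope sesquilinear_scope.

(* Conventions.  A vector of R^m is a sequence (or tuple) of length m, so that
   (x_{s+1}, ..., x_m) is [drop s x].  The entries of a sequence are numbered
   from 0, whereas all the indices i, j, r, s below are those of the usual
   mathematical notation and start from 1; hence the [.-1] in [nth]. *)

Definition is_minimum (A : nat -> Prop) (m : nat) : Prop :=
  A m /\ forall n : nat, A n -> (m <= n)%N.

Definition is_maximum (A : nat -> Prop) (m : nat) : Prop :=
  A m /\ forall n : nat, A n -> (n <= m)%N.

Section FrameOperator.
Variables (R : realType) (d : nat).

(* The matrix of z |-> <z, y> x, where <z, y> = y^* z. *)
Definition rank_one (x y : 'cV[R[i]]_d) : 'M[R[i]]_d := x *m y ^t*.

Definition frame_operator (n : nat) (F : 'I_n -> 'cV[R[i]]_d) : 'M[R[i]]_d :=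
  \sum_(i < n) rank_one (F i) (F i).

Definition eigenvalues_increasing (S : 'M[R[i]]_d) (lam : d.-tuple R) : Prop :=
  sorted <=%R lam /\ char_poly S = \prod_(x <- lam) ('X - (x%:C)%:P).

Definition initial_data (n0 k : nat) (F0 : 'I_n0 -> 'cV[R[i]]_d)
    (a : k.-tuple R) : Prop :=
  [/\ all (fun t : R => 0 < t) a, sorted >=%R a
    & (d - \rank (frame_operator F0) <= k)%N].

End FrameOperator.

Section Sequences.
Variable R : realType.
Implicit Types (x y lam a nu : seq R) (f : R -> R).

Definition entry x (i : nat) : R := nth 0 x i.-1.

Definition tr x : R := \sum_(t <- x) t.

Definition addv x y : seq R := [seq t.1 + t.2 | t <- zip x y].
Definition subv x y : seq R := [seq t.1 - t.2 | t <- zip x y].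

Definition zero_pad (n : nat) x : seq R := x ++ nseq (n - size x) 0.

Definition majorized x y : Prop :=
  let n := maxn (size x) (size y) in
  let xd := sort >=%R (zero_pad n x) in
  let yd := sort >=%R (zero_pad n y) in
  (forall j : nat, (j <= n)%N -> tr (take j xd) <= tr (take j yd))
  /\ tr x = tr y.

(* f is only relevant on [0, +oo[. *)
Definition strictly_convex_nneg f : Prop :=
  forall u v t : R, 0 <= u -> 0 <= v -> u != v -> 0 < t -> t < 1 ->
    f (t * u + (1 - t) * v) < t * f u + (1 - t) * f v.

Definition Gamma (d : nat) a (gam : d.-tuple R) : Prop :=
  [/\ all (fun t : R => 0 <= t) gam, sorted >=%R gam & majorized a gam].

(* mu = mu_f(lam, a) *)
Definition is_mu (d : nat) f (lam : d.-tuple R) a (mu : d.-tuple R) : Prop :=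
  Gamma a mu /\
  forall gam : d.-tuple R, Gamma a gam ->
    \sum_(i < d) f (tnth lam i + tnth mu i)
      <= \sum_(i < d) f (tnth lam i + tnth gam i).

Definition waterfill_const lam a (s : nat) : R :=
  (tr a + tr (take s lam)) / s%:R.

(* The unique s in {1, ..., d - 1} with lam_s <= c_s < lam_{s+1} when
   tr lam + tr a < d lam_d; [find] returns the first such s, shifted by 1. *)
Definition waterfill_index lam a : nat :=
  (find (fun s => (entry lam s <= waterfill_const lam a s) &&
                  (waterfill_const lam a s < entry lam s.+1))
        (iota 1 (size lam).-1)).+1.

(* nu(lam, a) for lam increasing of size d >= 1 (not to be confused with
   nu_f(lam, a) = lam + mu_f(lam, a)). *)
Definition waterfill lam a : seq R :=
  let d := size lam in
  let t := tr lam + tr a in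
  let s := waterfill_index lam a in
  if entry lam d <= t / d%:R then nseq d (t / d%:R)
  else nseq s (waterfill_const lam a s) ++ drop s lam.

Definition feasible lam a : Prop :=
  majorized a (subv (waterfill lam a) lam).

Definition feasible_index lam a (s : nat) : Prop :=
  feasible (drop s lam) (drop s a).

(* s_p *)
Definition last_nonzero (mu : seq R) : nat :=
  \max_(1 <= i < (size mu).+1 | entry mu i != 0) i.

(* [:: c_1; ...; c_p] *)
Definition levels lam (mu : seq R) : seq R :=
  sort >=%R (undup (take (last_nonzero mu) (addv lam mu))).

(* s_j, the right endpoint of K_j = {i <= s_p : lam_i + mu_i = c_j}; s_0 = 0. *)
Definition level_end lam (mu : seq R) (j : nat) : nat :=
  if j is 0 then 0 else
  \max_(1 <= i < (last_nonzero mu).+1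
        | entry (addv lam mu) i == entry (levels lam mu) j) i.

(* P_{j,r}, for 1 <= j <= r *)
Definition avg lam a (j r : nat) : R :=
  (\sum_(j <= i < r.+1) (entry lam i + entry a i)) / (r - j + 1)%:R.

End Sequences.

(* Main.v *)
Require Import Defs.
From HB Require Import structures.
From mathcomp Require Import all_boot all_order all_algebra.
From mathcomp Require Import spectral.
From mathcomp Require Import complex.
From mathcomp Require Import reals.
From mathcomp Require Import ring lra zify.

Set Implicit Arguments.
Unset Strict Implicit.
Unset Printing Implicit Defensive.

Import Order.TTheory GRing.Theory Num.Theory.
Local Open Scope ring_scope.
Local Open Scope complex_scope.

(** Write [l], [m] for the entries of [lam], [mu], numbered from 0, and
    [A_r], [M_r] for the partial sums of the first [r] entries of [a], [mu].
    The admissible [mu] are the decreasing nonnegative vectors with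
    [A_r <= M_r] for all [r] and [M_d = tr a].  A strictly convex sum decreases
    when a small amount of mass moves from an entry where [l + m] is large to
    one where it is small, so no such move is admissible at the minimizer.

    - Moving mass towards smaller indices only increases the partial sums.
      Hence [l + m] is decreasing on the support of [mu]
      ([optimal_total_antitone]).
    - Moving mass from [i] to [i + 1] only spoils the inequality for
      [M_(i+1)].  Hence [l + m] can drop between [i] and [i + 1] only if
      [M_(i+1) = A_(i+1)] ([optimal_drop_tight]); at the end of the support
      that equality is impossible when [i + 1 < d], because [a] is positive and
      has at least [d] entries ([optimal_support_end_le]).

    So [M = A] at every [s_j] with [j < p].  Between [s_j] and [s_(j+1)] the sum
    of [l + m], a constant [c_(j+1)], then equals the sum of [l + a], whereas
    for any other endpoint [r] the sum of [l + a] is at most that of [l + m],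
    and [l + m < c_(j+1)] beyond [s_(j+1)]: this is the maximal average of
    part 2 ([level_is_max_avg]).

    For part 1, the water-filling vector is [max c l] for the only [c] with the
    prescribed trace ([waterfill_flood], [flood_unique]).  From [s_(p-1)] on,
    [l + m] has this form with [c = c_p] ([optimal_flood]), so the water-filling
    solution of the truncated problem is the tail of [mu], and feasibility
    follows from [A_r <= M_r].  If an earlier index [q] were feasible, with
    level [c'], then [c' > c_p] would put too much mass after [s_(p-1)], while
    [c' <= c_p] would put too little between [q] and [s_(p-1)], where [mu] needs
    a level above [c_p] ([feasible_ge_last_start]). *)

(** * Partial sums and majorization *)

Section PartialSums.
Variable R : realType.
Implicit Types x y : seq R.

(** The default value 0 of [nth] makes [psum] insensitive to zero padding, so
    vectors of different sizes can be compared without reference to their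
    sizes. *)
Definition psum x (j : nat) : R := \sum_(0 <= i < j) x`_i.

Lemma psum0 x : psum x 0 = 0.
Proof. by rewrite /psum big_geq. Qed.

Lemma psumS x j : psum x j.+1 = psum x j + x`_j.
Proof. by rewrite /psum big_nat_recr. Qed.

Lemma tr_take x j : tr (take j x) = psum x j.
Proof.
rewrite /tr; elim: j => [|j IHj]; first by rewrite take0 big_nil psum0.
rewrite psumS -IHj; case: (ltnP j (size x)) => jx.
  by rewrite (take_nth 0) // big_rcons /= addrC.
by rewrite [x`_j]nth_default // !take_oversize ?(leq_trans jx) ?addr0.
Qed.

Lemma tr_psum x n : (size x <= n)%N -> tr x = psum x n.
Proof. by move=> xn; rewrite -tr_take take_oversize. Qed.

Lemma sum_psum x q r : (q <= r)%N -> \sum_(q <= i < r) x`_i = psum x r - psum x q.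
Proof.
move=> qr; rewrite /psum [\sum_(0 <= i < r) _](big_cat_nat (n := q)) //=; ring.
Qed.

Lemma psum_drop x q j : psum (drop q x) j = psum x (q + j) - psum x q.
Proof.
elim: j => [|j IHj]; first by rewrite addn0 subrr psum0.
by rewrite addnS !psumS IHj nth_drop addrAC.
Qed.

Lemma sorted_geP x :
  reflect (forall i : nat, (i.+1 < size x)%N -> x`_i.+1 <= x`_i) (sorted >=%R x).
Proof. exact: (sortedP 0). Qed.

Lemma antitone_of_sorted x :
  all (fun t => 0 <= t) x -> sorted >=%R x ->
  forall i j, (i <= j)%N -> x`_j <= x`_i.
Proof.
move=> x0 xs i j ij; case: (ltnP j (size x)) => jx.
  by apply: (sorted_leq_nth ge_trans ge_refl 0 xs) => //; exact: leq_ltn_trans jx.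
rewrite [x`_j]nth_default //; case: (ltnP i (size x)) => ix.
  exact: (allP x0 _ (mem_nth 0 ix)).
by rewrite nth_default.
Qed.

Lemma sort_zero_pad n x :
  all (fun t => 0 <= t) x -> sorted >=%R x ->
  sort >=%R (zero_pad n x) = zero_pad n x.
Proof.
move=> x0 xs; apply: (sorted_sort ge_trans); apply/sorted_geP => i _.
have pad j : (zero_pad n x)`_j = x`_j.
  rewrite /zero_pad nth_cat; case: ltnP => // xj.
  by rewrite nth_nseq if_same nth_default.
by rewrite !pad; apply: antitone_of_sorted.
Qed.

Lemma psum_zero_pad n x j : psum (zero_pad n x) j = psum x j.
Proof.
apply: eq_big_nat => i _; rewrite /zero_pad nth_cat; case: ltnP => // xj.
by rewrite nth_nseq if_same nth_default.
Qed.

(** Padding a decreasing nonnegative vector with zeros keeps it sorted, so the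
    rearrangements in the definition of majorization disappear. *)
Lemma majorized_psum x y :
  all (fun t => 0 <= t) x -> sorted >=%R x ->
  all (fun t => 0 <= t) y -> sorted >=%R y ->
  majorized x y <-> (forall j, psum x j <= psum y j) /\ tr x = tr y.
Proof.
move=> x0 xs y0 ys; rewrite /majorized /= !sort_zero_pad //.
split=> -[le_xy eq_xy]; split=> // j; last by rewrite !tr_take !psum_zero_pad.
case: (leqP j (maxn (size x) (size y))) => [/le_xy|].
  by rewrite !tr_take !psum_zero_pad.
rewrite gtn_max => /andP[xj yj].
by rewrite -!tr_psum ?(ltnW xj) ?(ltnW yj) // eq_xy.
Qed.

End PartialSums.

(** * Nonnegativity of the spectrum of a frame operator *)

Section FrameOperatorSpectrum.
Variables (R : realType) (d : nat).
Local Open Scope sesquilinear_scope.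

(** If [v S = z v] then [z |v|^2 = v S v^*], which is the sum of the squared
    moduli of the numbers [v f_i]. *)
Lemma frame_operator_eigenvalue_ge0 n (F : 'I_n -> 'cV[R[i]]_d) (z : R) :
  eigenvalue (frame_operator F) z%:C -> 0 <= z.
Proof.
case/eigenvalueP=> v vS v0; rewrite -ler0c.
have normE (w : 'rV[R[i]]_d) : (w *m w ^t*) 0 0 = \sum_j `|w 0 j| ^+ 2.
  by rewrite mxE; apply: eq_bigr => j _; rewrite !mxE normCK.
have v_gt0 : 0 < (v *m v ^t*) 0 0.
  rewrite normE lt0r sumr_ge0 ?andbT => [|j _]; last exact: exprn_ge0.
  apply: contraNneq v0 => sum0; apply/eqP/rowP => j; rewrite mxE.
  apply/eqP; rewrite -normr_eq0 -sqrf_eq0; apply/eqP.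
  by apply: (psumr_eq0P _ sum0) => // l _; exact: exprn_ge0.
rewrite -(pmulr_lge0 _ v_gt0).
have -> : z%:C * (v *m v ^t*) 0 0 = (v *m frame_operator F *m v ^t*) 0 0.
  by rewrite vS -scalemxAl [RHS]mxE.
rewrite /frame_operator mulmx_sumr mulmx_suml summxE; apply: sumr_ge0 => j _.
have -> : v *m rank_one (F j) (F j) *m v ^t* = (v *m F j) *m (v *m F j) ^t*.
  by rewrite /rank_one trmx_mul map_mxM !mulmxA.
by rewrite mxE big_ord1 !mxE mul_conjC_ge0.
Qed.

Lemma eigenvalues_increasing_ge0 n (F : 'I_n -> 'cV[R[i]]_d) (lam : d.-tuple R) :
  eigenvalues_increasing (frame_operator F) lam -> all (fun t => 0 <= t) lam.
Proof.
case=> _ char_eq; apply/allP => z z_lam.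
apply: (@frame_operator_eigenvalue_ge0 n F).
rewrite eigenvalue_root_char char_eq.
rewrite -(big_map (fun x : R => x%:C) predT (fun x => 'X - x%:P)).
by rewrite root_prod_XsubC map_f.
Qed.

End FrameOperatorSpectrum.

(** * Transfers of mass *)

Section Transfer.
Variable R : realType.
Implicit Types (f : R -> R) (a : seq R).

(** With [t = e / (y - x)], both [x + e] and [y - e] are convex combinations of
    [x] and [y], with exchanged weights. *)
Lemma strictly_convex_transfer f x y e : strictly_convex_nneg f ->
  0 <= x -> 0 < e -> e < y - x -> f (x + e) + f (y - e) < f x + f y.
Proof.
move=> hf x0 e0 e_lt; have xy : 0 < y - x by lra.
have y0 : 0 <= y by lra.
have xNy : x != y by apply/eqP => xy'; rewrite xy' subrr ltxx in xy.
pose t := e / (y - x).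
have t0 : 0 < t by rewrite divr_gt0.
have t1 : t < 1 by rewrite ltr_pdivrMr // mul1r.
have et : e = t * (y - x) by rewrite /t divfK // gt_eqF.
have := hf y x t y0 x0; rewrite eq_sym => /(_ xNy t0 t1).
have := hf x y t x0 y0 xNy t0 t1.
have -> : t * x + (1 - t) * y = y - e by rewrite et; ring.
have -> : t * y + (1 - t) * x = x + e by rewrite et; ring.
lra.
Qed.

(** Mass [e] moves from entry [j] to entry [i]. *)
Definition transfer d (mu : d.-tuple R) (i j : nat) (e : R) : d.-tuple R :=
  [tuple tnth mu l + ((l == i :> nat)%:R - (l == j :> nat)%:R) * e | l < d].

Lemma nth_transfer d (mu : d.-tuple R) i j e l : (l < d)%N ->
  (transfer mu i j e)`_l = mu`_l + ((l == i)%:R - (l == j)%:R) * e.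
Proof.
move=> ld; rewrite -[l]/(val (Ordinal ld)) -tnth_nth tnth_mktuple.
by rewrite (tnth_nth 0).
Qed.

Lemma psum_transfer d (mu : d.-tuple R) i j e r : (r <= d)%N ->
  psum (transfer mu i j e) r = psum mu r + ((i < r)%N%:R - (j < r)%N%:R) * e.
Proof.
elim: r => [|r IHr] rd; first by rewrite !psum0; lra.
rewrite !psumS IHr ?(ltnW rd) // nth_transfer //.
have lt_eq l : (l < r.+1)%N%:R = (l < r)%N%:R + (r == l)%:R :> R.
  by rewrite -natrD ltnS leq_eqVlt eq_sym; case: ltngtP.
rewrite !lt_eq; ring.
Qed.

(** The transfer brings [lam_i + mu_i] and [lam_j + mu_j] closer together, so by
    strict convexity it lowers the objective: it must leave [Gamma]. *)
Lemma is_mu_no_transfer d f (lam : d.-tuple R) a (mu : d.-tuple R) i j e :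
  strictly_convex_nneg f -> all (fun t => 0 <= t) lam -> is_mu f lam a mu ->
  (i < d)%N -> (j < d)%N ->
  0 < e -> e < (lam`_j + mu`_j) - (lam`_i + mu`_i) ->
  ~ Gamma a (transfer mu i j e).
Proof.
move=> hf lam0 [[mu0 _ _] mu_min] id jd e0 e_lt /mu_min.
apply/negP; rewrite -ltNge.
have ij : i != j by apply: contraTneq e_lt => ->; rewrite subrr -leNgt ltW.
have sum_ij (F : 'I_d -> R) : \sum_l F l = F (Ordinal id) + F (Ordinal jd)
    + \sum_(l | (l != Ordinal id) && (l != Ordinal jd)) F l.
  rewrite (bigD1 (Ordinal id)) //= (bigD1 (Ordinal jd)) /= ?addrA //.
  by rewrite eq_sym.
rewrite !sum_ij; set s1 := (X in _ + X < _); set s2 := (X in _ < _ + X).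
have -> : s1 = s2.
  apply: eq_bigr => l /andP[/eqP li /eqP lj]; rewrite tnth_mktuple.
  have -> : (l == i :> nat) = false by apply/eqP => h; apply: li; apply/val_inj.
  have -> : (l == j :> nat) = false by apply/eqP => h; apply: lj; apply/val_inj.
  by rewrite subrr mul0r addr0.
rewrite ltrD2r !tnth_mktuple !(tnth_nth 0) /= !eqxx (negPf ij) eq_sym (negPf ij).
rewrite subr0 sub0r mul1r mulN1r !addrA.
apply: strictly_convex_transfer => //; apply: addr_ge0.
  by apply: (allP lam0); rewrite mem_nth ?size_tuple.
by apply: (allP mu0); rewrite mem_nth ?size_tuple.
Qed.

(** Membership in [Gamma] as inequalities on entries and partial sums, the form
    in which the effect of a transfer is read off. *)
Lemma Gamma_psum d k (a : k.-tuple R) (gam : d.-tuple R) : (d <= k)%N ->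
  all (fun t => 0 <= t) a -> sorted >=%R a ->
  Gamma a gam <->
  [/\ forall i, (i < d)%N -> 0 <= gam`_i,
      forall i, (i.+1 < d)%N -> gam`_i.+1 <= gam`_i,
      forall j, (j <= d)%N -> psum a j <= psum gam j
    & psum gam d = psum a k].
Proof.
move=> dk a0 sa.
have szs : (size gam = d) * (size a = k) by rewrite !size_tuple.
split=> [[gam0 sgam]|[gam0 sgam le_ag eq_ag]].
  case/(majorized_psum a0 sa gam0 sgam) => le_ag eq_ag; split.
  - by move=> i id; apply: (allP gam0); rewrite mem_nth ?szs.
  - by move=> i id; apply/(sorted_geP _ sgam); rewrite szs.
  - by move=> j _; apply: le_ag.
  - by rewrite -!tr_psum ?szs.
have gam_ge0 : all (fun t => 0 <= t) gam.
  by apply/(all_nthP 0) => i; rewrite szs; apply: gam0.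
have sorted_gam : sorted >=%R gam.
  by apply/sorted_geP => i; rewrite szs; apply: sgam.
split=> //; apply/majorized_psum => //; split; last first.
  by rewrite (@tr_psum _ _ k) ?szs // (@tr_psum _ _ d) ?szs.
move=> j; case: (leqP j d) => [/le_ag //|dj].
have -> : psum gam j = psum a k.
  by rewrite -eq_ag -!tr_psum ?szs ?(ltnW dj).
case: (leqP j k) => jk; last by rewrite -!tr_psum ?szs ?(ltnW jk).
rewrite -subr_ge0 -sum_psum // big_nat sumr_ge0 // => i /andP[_ ik].
by apply: (allP a0); rewrite mem_nth ?szs.
Qed.

End Transfer.
(** * Optimality conditions *)

Section Optimality.
Variables (R : realType) (d k : nat) (f : R -> R).
Variables (lam mu : d.-tuple R) (a : k.-tuple R).
Hypotheses (dk : (d <= k)%N) (hf : strictly_convex_nneg f).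
Hypotheses (a0 : all (fun t => 0 < t) a) (sa : sorted >=%R a).
Hypotheses (lam0 : all (fun t => 0 <= t) lam) (slam : sorted <=%R lam).
Hypothesis hmu : is_mu f lam a mu.

Let a_ge0 : all (fun t => 0 <= t) a.
Proof. by apply: sub_all a0 => t; apply: ltW. Qed.

Let Gamma_mu := Gamma_psum mu dk a_ge0 sa.

Lemma is_mu_antitone i j : (i <= j)%N -> mu`_j <= mu`_i.
Proof. by case: hmu => -[mu0 smu _] _; apply: antitone_of_sorted. Qed.

Lemma is_mu_ge0 i : 0 <= mu`_i.
Proof.
case: hmu => -[mu0 smu _] _; case: (ltnP i d) => id.
  by apply: (allP mu0); rewrite mem_nth ?size_tuple.
by rewrite nth_default ?size_tuple.
Qed.

Lemma lam_monotone i j : (i <= j)%N -> (j < d)%N -> lam`_i <= lam`_j.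
Proof.
move=> ij jd.
by apply: (le_sorted_leq_nth 0 slam); rewrite ?inE ?size_tuple // (leq_ltn_trans ij).
Qed.

(** A transfer to the left preserves the majorization constraint but may break
    the monotonicity of [mu].  This is avoided by starting at the extreme
    offending pair: the smallest possible [i] and then the largest possible
    [j].  As [lam] is increasing, equality of [mu] at [i - 1] and [i], or at [j]
    and [j + 1], would give a still more extreme pair. *)
Lemma optimal_total_antitone i j : (i < j)%N -> 0 < mu`_j ->
  lam`_j + mu`_j <= lam`_i + mu`_i.
Proof.
have mu_lt_d r : 0 < mu`_r -> (r < d)%N.
  by rewrite ltNge; apply: contraNltn => dr; rewrite nth_default ?size_tuple.
pose rises i r := [&& (i < r)%N, 0 < mu`_r & lam`_i + mu`_i < lam`_r + mu`_r].
suff no_rise i' : ~~ [exists r : 'I_d, rises i' r].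
  move=> ij muj; have jd := mu_lt_d _ muj; rewrite leNgt; apply/negP => rise.
  by move/existsP: (no_rise i); apply; exists (Ordinal jd); rewrite /rises /= ij muj.
apply/negP => rise0.
have : exists i, [exists r : 'I_d, rises i r] by exists i'.
clear i j i' rise0 => /ex_minnP[i /existsP[r0 r0P] i_min].
have ex_r : exists r, rises i r by exists r0.
have r_le r : rises i r -> (r <= d)%N by case/and3P => _ /mu_lt_d /ltnW.
case: (ex_maxnP ex_r r_le) => {r0 r0P ex_r r_le} j /and3P[ij muj rise] j_max.
have jd := mu_lt_d _ muj.
have step_j : mu`_j.+1 < mu`_j.
  rewrite lt_neqAle is_mu_antitone // andbT; apply/eqP => mu_eq.
  have jSd : (j.+1 < d)%N by apply: mu_lt_d; rewrite mu_eq.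
  have := lam_monotone (leqnSn j) jSd => lam_le.
  have := j_max j.+1; rewrite /rises ltnn mu_eq muj ltnS (ltnW ij) /=.
  by rewrite (lt_le_trans rise) ?lerD2r // => /(_ isT).
(* At [i = 0] nothing precedes the entry that grows, and any positive bound
   will do. *)
pose gap := if i is i'.+1 then mu`_i' - mu`_i'.+1 else 1.
have step_i : 0 < gap.
  rewrite /gap; case: (i) i_min ij rise => // i' i_min ij rise.
  rewrite subr_gt0 lt_neqAle is_mu_antitone // andbT; apply/eqP => mu_eq.
  have lam_le := lam_monotone (leqnSn i') (ltn_trans ij jd).
  have := i_min i'; rewrite ltnn => absurd; suff: false by [].
  apply: absurd; apply/existsP; exists (Ordinal jd); rewrite /rises /=.
  by rewrite ltnW //= muj -mu_eq (le_lt_trans _ rise) // lerD2r.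
pose e := Num.min ((lam`_j + mu`_j - (lam`_i + mu`_i)) / 2)
  (Num.min (mu`_j - mu`_j.+1) gap).
have e0 : 0 < e by rewrite !lt_min step_i subr_gt0 step_j divr_gt0 // subr_gt0.
have : e <= e by []; rewrite {2}/e !le_min => /and3P[e_rise e_j e_i].
apply: (is_mu_no_transfer hf lam0 hmu (ltn_trans ij jd) jd e0); first by lra.
case/Gamma_mu: (hmu.1) => mu0 smu le_amu eq_amu.
apply/(Gamma_psum _ dk a_ge0 sa); split.
- move=> l ld; rewrite nth_transfer //; have mul := mu0 l ld.
  have := is_mu_ge0 j.+1; case: (l =P j) => [->|_]; case: eqP => _ /=; lra.
- move=> l lSd; have ld := ltnW lSd; rewrite !nth_transfer //.
  have := smu l lSd; case: (l.+1 =P i) => [li|_].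
    have lj : (l.+1 < j)%N by rewrite li.
    move: e_i; rewrite /gap -li (ltn_eqF (ltnSn l)) (ltn_eqF lj).
    by rewrite (ltn_eqF (ltnW lj)) /=; lra.
  case: (l =P j) => [->|_]; last first.
    by case: (l.+1 == j); case: (l == i) => /=; lra.
  by rewrite (gtn_eqF ij) (gtn_eqF (ltnSn j)) /=; lra.
- move=> r rd; rewrite psum_transfer //; have := le_amu r rd.
  by case: (ltnP j r) => [/(ltn_trans ij) ->|_]; case: (i < r)%N => /=; lra.
- by rewrite psum_transfer // jd (ltn_trans ij jd) -eq_amu; lra.
Qed.

(** Among the partial sums, a transfer from [i] to [i + 1] lowers only that of
    length [i + 1].  It keeps [mu] decreasing because [lam] increases: [mu] drops
    there by at least as much as [lam + mu], and half of that drop may be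
    moved. *)
Lemma optimal_drop_tight i : (i.+1 < d)%N ->
  lam`_i.+1 + mu`_i.+1 < lam`_i + mu`_i -> psum mu i.+1 = psum a i.+1.
Proof.
move=> iSd drop_i; have id := ltnW iSd.
case/Gamma_mu: (hmu.1) => mu0 smu le_amu eq_amu.
apply/eqP; rewrite eq_le le_amu ?andbT // leNgt; apply/negP => slack.
pose e := Num.min ((lam`_i + mu`_i - (lam`_i.+1 + mu`_i.+1)) / 2)
  (psum mu i.+1 - psum a i.+1).
have e0 : 0 < e by rewrite !lt_min subr_gt0 slack divr_gt0 // subr_gt0.
have : e <= e by []; rewrite {2}/e !le_min => /andP[e_drop e_slack].
have lam_le := lam_monotone (leqnSn i) iSd.
apply: (is_mu_no_transfer hf lam0 hmu iSd id e0); first by lra.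
apply/(Gamma_psum _ dk a_ge0 sa); split.
- move=> l ld; rewrite nth_transfer //; have := mu0 l ld.
  have := mu0 _ iSd; case: (l =P i) => [->|_]; case: eqP => _ /=; lra.
- move=> l lSd; have ld := ltnW lSd; rewrite !nth_transfer //.
  have := smu l lSd; case: (eqVneq l i) => [->|li].
    by rewrite !eqxx (ltn_eqF (ltnSn i)) (gtn_eqF (ltnSn i)) /=; lra.
  by rewrite eqSS (negPf li); case: (l == i.+1); case: (l.+1 == i) => /=; lra.
- move=> r rd; rewrite psum_transfer //; have := le_amu r rd.
  case: (ltngtP i.+1 r) => [_|_|<-] /=; lra.
- by rewrite psum_transfer // iSd id -eq_amu; lra.
Qed.

(** Otherwise the partial sums of [mu] and [a] agree at [i + 1].  All the mass of
    [mu] lies there, so [a] would have no mass beyond, but its next entry exists,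
    since [i + 1 < d <= k], and is positive. *)
Lemma optimal_support_end_le i : (i.+1 < d)%N -> mu`_i.+1 = 0 ->
  lam`_i + mu`_i <= lam`_i.+1.
Proof.
move=> iSd mu_eq; rewrite leNgt; apply/negP => drop_i.
have := optimal_drop_tight iSd; rewrite mu_eq addr0 => /(_ drop_i) tight.
case/Gamma_mu: (hmu.1) => _ _ _ eq_amu.
have ad : 0 < a`_i.+1 by apply: (allP a0); rewrite mem_nth ?size_tuple // (leq_trans iSd).
have : psum mu d = psum mu i.+1.
  apply/eqP; rewrite -subr_eq0 -sum_psum 1?ltnW // big_nat big1 // => l /andP[il _].
  by apply/eqP; rewrite eq_le is_mu_ge0 andbT -[X in _ <= X]mu_eq is_mu_antitone.
rewrite eq_amu tight => /eqP; rewrite -subr_eq0 -sum_psum; last by lia.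
rewrite big_ltn; last by lia.
apply/negP; rewrite gt_eqF // ltr_pwDl // big_nat sumr_ge0 // => l /andP[_ lk].
by apply: (allP a_ge0); rewrite mem_nth ?size_tuple.
Qed.

End Optimality.

(** * Water-filling *)

Section WaterFilling.
Variable R : realType.
Implicit Types (lam a : seq R) (c : R).

(** Raising the low entries to a common level [c] is the map [max c].  If the
    flood does not cover everything, the index sought is the least [s] whose
    level is below the next entry: minimality gives [lam_s <= c_s], because
    [s c_s = (s - 1) c_(s-1) + lam_s] (entries numbered from 1) and [c_(s-1) >= lam_s]. *)
Lemma waterfill_flood lam a : (0 < size lam)%N -> sorted <=%R lam -> 0 <= tr a ->
  exists c, waterfill lam a = [seq Num.max c t | t <- lam]
    /\ \sum_(0 <= i < size lam) (Num.max c lam`_i - lam`_i) = tr a.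
Proof.
move=> lam_gt0 slam a0; set d := size lam.
have lam_le i j : (i <= j)%N -> (j < d)%N -> lam`_i <= lam`_j.
  move=> ij jd.
  by apply: (le_sorted_leq_nth 0 slam); rewrite ?inE // (leq_ltn_trans ij).
have d0 : d%:R != 0 :> R by rewrite pnatr_eq0 -lt0n.
rewrite /waterfill -/d; case: ifP => [high|/negbT].
  set c := (tr lam + tr a) / d%:R in high *.
  have le_c i : (i < d)%N -> lam`_i <= c.
    by move=> id; apply: le_trans high; apply: lam_le; lia.
  exists c; split.
    apply: (@eq_from_nth _ 0) => [|i]; rewrite size_nseq ?size_map // => id.
    by rewrite nth_nseq id (nth_map 0) // max_l // le_c.
  rewrite (eq_big_nat _ _ (F2 := fun i => c - lam`_i)); last first.
    by move=> i /andP[_ id]; rewrite max_l // le_c.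
  rewrite sumrB sumr_const_nat subn0 -mulr_natr divfK //.
  by rewrite (tr_psum (leqnn d)) /psum; ring.
rewrite -ltNge ltr_pdivrMr ?ltr0n // => low.
pose fits s := (entry lam s <= waterfill_const lam a s)
  && (waterfill_const lam a s < entry lam s.+1).
have fits_has : has fits (iota 1 d.-1).
  pose below s := (0 < s)%N && (waterfill_const lam a s < entry lam s.+1).
  have d1 : (1 < d)%N.
    rewrite ltnNge; apply/negP => d_le1; have dE : d = 1%N by lia.
    by move: low; rewrite (tr_psum (leqnn d)) /entry dE psumS psum0 /=; lra.
  have below_last : below d.-1.
    rewrite /below /waterfill_const tr_take ltr_pdivrMr; last by rewrite ltr0n; lia.
    have dE : d = d.-1.+1 by lia.
    have dR : d%:R = d.-1%:R + 1 :> R by rewrite natr1 -dE.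
    have psum_last : psum lam d = psum lam d.-1 + lam`_d.-1 by rewrite {1}dE psumS.
    move: low; rewrite (tr_psum (leqnn d)) psum_last dR /entry /= => low.
    by apply/andP; split; [lia | lra].
  have ex_below : exists s, below s by exists d.-1.
  case: (ex_minnP ex_below) => s /andP[s0 s_below] s_min.
  have s_le := s_min _ below_last.
  apply/hasP; exists s; first by rewrite mem_iota; lia.
  rewrite /fits s_below andbT /waterfill_const ler_pdivlMr ?ltr0n // tr_take.
  case: s s0 s_below s_min s_le => // s _ _ s_min s_le; rewrite psumS /entry /=.
  rewrite -natr1 mulrDr mulr1 addrA lerD2r.
  case: s s_min s_le => [|s] s_min s_le; first by rewrite mulr0 psum0 addr0.
  have := s_min s.+1; rewrite /below /= ltnn -ler_pdivlMr ?ltr0n //.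
  rewrite /waterfill_const tr_take /entry /=.
  by case: ltP => // _ /(_ isT).
set s := waterfill_index lam a.
have sE : s = nth 0%N (iota 1 d.-1) (find fits (iota 1 d.-1)).
  by rewrite nth_iota ?add1n // -[X in (_ < X)%N](size_iota 1) -has_find.
have : fits s by rewrite sE nth_find.
have sP : s \in iota 1 d.-1 by rewrite sE mem_nth // -has_find.
have [s0 sd] : (0 < s)%N /\ (s < d)%N.
  by move: sP (lam_gt0 : (0 < d)%N); rewrite mem_iota; clearbody s; lia.
clearbody s.
set c := waterfill_const lam a s => /andP[] /=.
rewrite -/c /entry /= => c_ge c_lt.
have low_part i : (i < s)%N -> Num.max c lam`_i = c.
  move=> is_; rewrite max_l // (le_trans _ c_ge) // lam_le //.
    by rewrite -ltnS prednK.
  exact: leq_ltn_trans (leq_pred s) sd.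
have high_part i : (s <= i)%N -> (i < d)%N -> Num.max c lam`_i = lam`_i.
  by move=> si id; rewrite max_r // (le_trans (ltW c_lt)) // lam_le.
exists c; split.
  apply: (@eq_from_nth _ 0); first by rewrite size_cat size_nseq size_drop size_map subnKC // ltnW.
  move=> i; rewrite size_cat size_nseq size_drop -/d subnKC ?(ltnW sd) // => id.
  rewrite (nth_map 0) // nth_cat size_nseq nth_nseq.
  case: ltnP => si; first by rewrite low_part.
  by rewrite nth_drop subnKC // high_part.
rewrite (big_cat_nat (n := s)) //=; last exact: ltnW.
rewrite [X in _ + X]big_nat [X in _ + X]big1 ?addr0; last first.
  by move=> i /andP[si id]; rewrite high_part ?subrr.
rewrite (eq_big_nat _ _ (F2 := fun i => c - lam`_i)); last first.
  by move=> i /andP[_ id]; rewrite low_part.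
rewrite sumrB sumr_const_nat subn0 -mulr_natr /c /waterfill_const divfK.
  by rewrite tr_take /psum addrK.
by rewrite pnatr_eq0 -lt0n.
Qed.

(** The volume poured is monotone in the level, termwise; equal volumes therefore
    force equal terms. *)
Lemma flood_le_unique (l : nat -> R) c c' q r : c <= c' ->
  \sum_(q <= i < r) (Num.max c (l i) - l i) =
    \sum_(q <= i < r) (Num.max c' (l i) - l i) ->
  forall i, (q <= i < r)%N -> Num.max c (l i) = Num.max c' (l i).
Proof.
move=> cc' eq_sum i /andP[qi ir].
have le_max j : Num.max c (l j) <= Num.max c' (l j) by rewrite ge_max !le_max cc' lexx orbT.
apply/eqP; rewrite eq_le le_max leNgt; apply/negP => lt_max.
have : \sum_(q <= j < r) (Num.max c (l j) - l j) <
       \sum_(q <= j < r) (Num.max c' (l j) - l j).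
  rewrite !(big_cat_nat qi (ltnW ir)) /= !(big_ltn ir).
  have le_sum m n : \sum_(m <= j < n) (Num.max c (l j) - l j) <=
      \sum_(m <= j < n) (Num.max c' (l j) - l j).
    by apply: ler_sum => j _; rewrite lerD2r.
  by rewrite ler_ltD // ltr_leD // ltrD2r.
by rewrite eq_sum ltxx.
Qed.

Lemma flood_unique (l : nat -> R) c c' q r :
  \sum_(q <= i < r) (Num.max c (l i) - l i) =
    \sum_(q <= i < r) (Num.max c' (l i) - l i) ->
  forall i, (q <= i < r)%N -> Num.max c (l i) = Num.max c' (l i).
Proof.
move=> eq_sum i qir; case: (leP c c') => [cc'|/ltW c'c].
  exact: flood_le_unique eq_sum i qir.
by apply/esym; apply: flood_le_unique (esym eq_sum) i qir.
Qed.

(** Feasibility of [q] in terms of the water level of the truncated problem,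
    stated with sums over the original indices so that different truncations
    can be compared. *)
Lemma feasible_index_flood d k (lam : d.-tuple R) (a : k.-tuple R) q :
  (d <= k)%N -> (q < d)%N -> all (fun t => 0 < t) a -> sorted >=%R a ->
  sorted <=%R lam ->
  exists c,
    \sum_(q <= i < d) (Num.max c lam`_i - lam`_i) = psum a k - psum a q
    /\ (feasible_index lam a q <->
        forall r, (q <= r <= d)%N ->
          psum a r - psum a q <= \sum_(q <= i < r) (Num.max c lam`_i - lam`_i)).
Proof.
move=> dk qd a0 sa slam.
have szs : (size lam = d) * (size a = k) by rewrite !size_tuple.
have trE : tr (drop q a) = psum a k - psum a q.
  by rewrite (tr_psum (leqnn _)) psum_drop size_drop szs subnKC //; lia.
have a'0 : all (fun t => 0 <= t) (drop q a).
  by apply/allP => t /mem_drop; move/(allP a0); apply: ltW.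
have sa' : sorted >=%R (drop q a) by apply: drop_sorted.
have tr_ge0 : 0 <= tr (drop q a).
  by rewrite /tr big_seq sumr_ge0 // => t; apply: (allP a'0).
have slam' : sorted <=%R (drop q lam) by apply: drop_sorted.
have size_lam' : size (drop q lam) = (d - q)%N by rewrite size_drop szs.
have lam'_gt0 : (0 < size (drop q lam))%N by rewrite size_lam' subn_gt0.
have [c [wE sumE]] := waterfill_flood lam'_gt0 slam' tr_ge0.
have shift r : (q <= r)%N ->
    \sum_(0 <= i < r - q) (Num.max c (drop q lam)`_i - (drop q lam)`_i)
    = \sum_(q <= i < r) (Num.max c lam`_i - lam`_i).
  move=> qr; rewrite -[q in RHS]add0n big_addn.
  by apply: eq_big_nat => i _; rewrite nth_drop addnC.
rewrite size_lam' shift 1?ltnW // trE in sumE.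
exists c; split=> //.
set w := subv (waterfill (drop q lam) (drop q a)) (drop q lam).
have size_w : size w = (d - q)%N.
  by rewrite size_map size_zip wE size_map size_lam' minnn.
have nth_w i : (i < d - q)%N ->
    w`_i = Num.max c (drop q lam)`_i - (drop q lam)`_i.
  move=> id; rewrite (nth_map (0, 0)) ?nth_zip ?size_zip wE ?size_map ?minnn ?size_lam' //=.
  by rewrite (nth_map 0) ?size_lam'.
have w0 : all (fun t => 0 <= t) w.
  apply/(all_nthP 0) => i; rewrite size_w => id.
  by rewrite nth_w // subr_ge0 le_max lexx orbT.
have sw : sorted >=%R w.
  apply/sorted_geP => i; rewrite size_w => id; rewrite !nth_w ?(ltnW id) //.
  have : (drop q lam)`_i <= (drop q lam)`_i.+1.
    by apply/(sortedP 0 slam'); rewrite size_lam'.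
  move: (drop q lam)`_i (drop q lam)`_i.+1 => x y xy.
  by case: (leP c x); case: (leP c y); lra.
have psum_w r : (q <= r <= d)%N ->
    psum w (r - q) = \sum_(q <= i < r) (Num.max c lam`_i - lam`_i).
  case/andP=> qr rd; rewrite -shift //; apply: eq_big_nat => i /andP[_ ir].
  by rewrite nth_w //; lia.
have tr_w : tr w = tr (drop q a).
  by rewrite (tr_psum (leqnn _)) size_w psum_w ?leqnn ?(ltnW qd) // sumE.
rewrite /feasible_index /feasible -/w majorized_psum //; split.
  case=> le_aw _ r /andP[qr rd]; have := le_aw (r - q)%N.
  by rewrite psum_drop subnKC // psum_w // qr.
move=> le_aw; split=> // j; case: (leqP j (d - q)) => jd.
  have := le_aw (q + j)%N; rewrite -psum_w ?addKn -?psum_drop; last by lia.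
  by apply; lia.
have -> : psum w j = tr (drop q a) by rewrite -tr_w (@tr_psum _ w j) // size_w ltnW.
rewrite -tr_take -[X in _ <= tr X](cat_take_drop j) /tr big_cat /=.
rewrite lerDl big_seq sumr_ge0 // => t /mem_drop; exact: (allP a'0).
Qed.

End WaterFilling.

(** * Levels of a decreasing sequence *)

Section Levels.
Variables (R : realType) (lam mu : seq R).
Let v := Defs.addv lam mu.
Let n := last_nonzero mu.
Let p := size (levels lam mu).
Let c := entry (levels lam mu).
Let s := level_end lam mu.
Hypotheses (n_le : (n <= size v)%N).
Hypothesis v_anti : forall i j, (i <= j)%N -> (j < n)%N -> v`_j <= v`_i.

Lemma mem_levels t : reflect (exists2 i, (i < n)%N & v`_i = t) (t \in levels lam mu).
Proof.
rewrite mem_sort mem_undup -/n -/v; apply: (iffP (nthP 0)) => -[m].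
  by rewrite size_takel // => m_n; rewrite nth_take // => <-; exists m.
by move=> m_n <-; exists m; rewrite ?size_takel ?nth_take.
Qed.

Lemma level_attained j : (1 <= j <= p)%N -> exists2 i, (i < n)%N & v`_i = c j.
Proof. by move=> j_p; apply/mem_levels; rewrite mem_nth // -/p; lia. Qed.

Lemma value_is_level i : (i < n)%N -> exists2 j, (1 <= j <= p)%N & v`_i = c j.
Proof.
move=> i_n; have /(nthP 0)[j j_p vE] : v`_i \in levels lam mu.
  by apply/mem_levels; exists i.
by exists j.+1; rewrite // /c /entry.
Qed.

Lemma level_lt j j' : (1 <= j)%N -> (j < j' <= p)%N -> c j' < c j.
Proof.
move=> j_gt0 j'_p; rewrite lt_neqAle; apply/andP; split.
  rewrite /c /entry nth_uniq -/p ?sort_uniq ?undup_uniq //; lia.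
have sorted_L : sorted >=%R (levels lam mu).
  by apply: sort_sorted => x y; exact: le_total.
by apply: (sorted_leq_nth ge_trans ge_refl 0 sorted_L); rewrite ?inE -/p; lia.
Qed.

(** The last index where the value is [c_j] is also the last one where it is at
    least [c_j], since the values are decreasing.  All facts about the [s_j]
    reduce to this characterization. *)
Lemma level_endP j i : (1 <= j <= p)%N -> (i < n)%N -> (i < s j)%N = (c j <= v`_i).
Proof.
case: j => // j j_p i_n; rewrite /s /level_end -/n -/v -/c.
apply/idP/idP; last first.
  move=> le_cv; have [i0 i0_n i0E] := level_attained j_p.
  (* The value is squeezed to [c_j] at the larger of [i] and an index where it
     is attained. *)
  pose m := maxn i i0.
  have m_n : (m < n)%N by rewrite gtn_max i_n.
  have vm : v`_m = c j.+1.
    apply/eqP; rewrite eq_le -{1}i0E v_anti ?leq_maxr //= /m.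
    by case: (leqP i i0); rewrite ?i0E.
  apply: (@leq_trans m.+1); first by rewrite ltnS leq_maxl.
  by apply: leq_bigmax_seq; rewrite ?mem_index_iota // /entry vm.
apply: contraTT; rewrite -ltNge -leqNgt => lt_vc.
apply/bigmax_leqP_seq => i' i'_n /eqP i'E; rewrite leqNgt; apply/negP => i_i'.
move: i'_n; rewrite mem_index_iota => i'_n.
have : v`_i'.-1 <= v`_i by apply: v_anti; lia.
by rewrite leNgt -[v`_i'.-1]/(entry v i') i'E lt_vc.
Qed.

Lemma level_end_le j : (s j <= n)%N.
Proof.
case: j => // j; apply/bigmax_leqP_seq => i; rewrite mem_index_iota.
by case/andP.
Qed.

Lemma level_end_lt j : (j < p)%N -> (s j < s j.+1)%N.
Proof.
move=> j_p; have j1 : (1 <= j.+1 <= p)%N by lia.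
have [i i_n vE] := level_attained j1.
apply: (@leq_ltn_trans i); last by rewrite level_endP // vE.
case: j j_p j1 vE => // j j_p j1 vE.
by rewrite leqNgt level_endP ?vE -?ltNge ?level_lt //; lia.
Qed.

Lemma level_end_mono j j' : (j <= j' <= p)%N -> (s j <= s j')%N.
Proof.
elim: j' => [|j' IHj'] jj'; first by have -> : j = 0%N by lia.
have [-> //|jj'_neq] := eqVneq j j'.+1.
apply: leq_trans (IHj' _) (ltnW (level_end_lt _)); lia.
Qed.

Lemma level_end_last : (0 < p)%N -> s p = n.
Proof.
move=> p0; apply/eqP; rewrite eqn_leq level_end_le /=.
case n_gt0 : n => [//|n']; have n'_n : (n' < n)%N by rewrite n_gt0.
rewrite level_endP ?p0 ?leqnn //.
have [j j_p ->] := value_is_level n'_n.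
have [-> //|jp] := eqVneq j p.
by apply/ltW/level_lt; lia.
Qed.

(** The value is one of the levels, is at least [c_(j+1)], and is below [c_j]
    when [j] is positive. *)
Lemma value_on_level j i : (j < p)%N -> (s j <= i < s j.+1)%N -> v`_i = c j.+1.
Proof.
move=> j_p /andP[ji ij]; have i_n := leq_trans ij (level_end_le j.+1).
have [j' j'_p vE] := value_is_level i_n; rewrite vE; congr c.
have j'_lt m : (1 <= m <= p)%N -> (i < s m)%N = (j' <= m)%N.
  move=> m_p; rewrite level_endP // vE; case: (leqP j' m) => [|lt_mj'].
    rewrite leq_eqVlt => /predU1P[->|jm]; first by rewrite lexx.
    by apply/ltW/level_lt; lia.
  by apply/negbTE; rewrite -ltNge level_lt //; lia.
move: ij; rewrite j'_lt; last by lia.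
case: j j_p ji => [|j] j_p ji; first by lia.
by move: ji; rewrite leqNgt j'_lt; lia.
Qed.

End Levels.

Lemma last_nonzeroP (R : realType) (mu : seq R) i :
  (forall i, 0 <= mu`_i) -> (forall i j, (i <= j)%N -> mu`_j <= mu`_i) ->
  (i < last_nonzero mu)%N = (0 < mu`_i).
Proof.
move=> mu0 mu_anti; apply/idP/idP.
  apply: contraTT; rewrite -leNgt -leqNgt => mui.
  apply/bigmax_leqP_seq => i' i'_n; apply: contraNT; rewrite -ltnNge => ii'.
  rewrite eq_le mu0 andbT (le_trans _ mui) // mu_anti //; lia.
move=> mui; have i_lt : (i < size mu)%N.
  by rewrite ltnNge; apply: contraTN mui => ?; rewrite nth_default ?ltxx.
by apply: leq_bigmax_seq; rewrite ?mem_index_iota // /entry gt_eqF.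
Qed.

(** * Structure of the minimizer *)

Section OptimalStructure.
Variables (R : realType) (d k : nat) (f : R -> R).
Variables (lam mu : d.-tuple R) (a : k.-tuple R).
Hypotheses (d0 : (0 < d)%N) (dk : (d <= k)%N) (hf : strictly_convex_nneg f).
Hypotheses (a0 : all (fun t => 0 < t) a) (sa : sorted >=%R a).
Hypotheses (lam0 : all (fun t => 0 <= t) lam) (slam : sorted <=%R lam).
Hypothesis hmu : is_mu f lam a mu.

Let v := Defs.addv lam mu.
Let n := last_nonzero mu.
Let p := size (levels lam mu).
Let c := entry (levels lam mu).
Let s := level_end lam mu.

Let a_ge0 : all (fun t => 0 <= t) a.
Proof. by apply: sub_all a0 => t; apply: ltW. Qed.

Let mu_ge0 i : 0 <= mu`_i. Proof. exact: is_mu_ge0 hmu i. Qed.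

Let mu_prefix : (forall j, (j <= d)%N -> psum a j <= psum mu j)
  /\ psum mu d = psum a k.
Proof. by case/(Gamma_psum mu dk a_ge0 sa): hmu.1. Qed.

Let nth_v i : (i < d)%N -> v`_i = lam`_i + mu`_i.
Proof.
by move=> id; rewrite (nth_map (0, 0)) ?nth_zip ?size_zip ?size_tuple // minnn.
Qed.

Let n_iff i : (i < n)%N = (0 < mu`_i).
Proof. by apply: last_nonzeroP => // i' j'; exact: is_mu_antitone hmu i' j'. Qed.

Let n_le_d : (n <= d)%N.
Proof.
rewrite leqNgt; apply/negP; rewrite n_iff nth_default ?size_tuple //.
by rewrite ltxx.
Qed.

Let size_v : size v = d.
Proof. by rewrite size_map size_zip !size_tuple minnn. Qed.

Let n_le : (n <= size v)%N. Proof. by rewrite size_v. Qed.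

Let v_anti i j : (i <= j)%N -> (j < n)%N -> v`_j <= v`_i.
Proof.
move=> ij jn; have jd := leq_trans jn n_le_d.
rewrite !nth_v //; last exact: leq_ltn_trans ij jd.
move: ij; rewrite leq_eqVlt => /predU1P[-> //|ij].
by apply: (optimal_total_antitone dk hf a0 sa lam0 slam hmu) => //; rewrite -n_iff.
Qed.

Let n_gt0 : (0 < n)%N.
Proof.
rewrite n_iff lt_neqAle mu_ge0 andbT; apply/eqP => mu_eq.
have : psum mu d = 0.
  rewrite /psum big1 // => i _; apply/eqP; rewrite eq_le mu_ge0 andbT.
  by rewrite [X in _ <= X]mu_eq (is_mu_antitone hmu).
rewrite mu_prefix.2 /psum big_ltn; last exact: leq_trans dk.
apply/eqP; rewrite gt_eqF // ltr_pwDl //.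
  by apply: (allP a0); rewrite mem_nth ?size_tuple // (leq_trans d0).
rewrite big_nat sumr_ge0 // => i /andP[_ ik].
by apply: (allP a_ge0); rewrite mem_nth ?size_tuple.
Qed.

Let p_gt0 : (0 < p)%N.
Proof. by have [j] := value_is_level n_le n_gt0; rewrite -/p; lia. Qed.

Let s_last : s p = n. Proof. exact: level_end_last. Qed.

Let last_start_lt : (s p.-1 < n)%N.
Proof. by rewrite -s_last -{2}(prednK p_gt0) level_end_lt ?prednK. Qed.

(** At [s_j] the values drop from [c_j] to [c_(j+1)], and a drop forces equal
    partial sums. *)
Lemma level_end_tight j : (j < p)%N -> psum mu (s j) = psum a (s j).
Proof.
case: j => [|j] jp; first by rewrite /s /= !psum0.
have lt_j : (s j < s j.+1)%N by apply: level_end_lt; rewrite // -/p ltnW.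
have lt_jS : (s j.+1 < s j.+2)%N by apply: level_end_lt.
have lt_n : (s j.+1 < n)%N := leq_trans lt_jS (level_end_le _ _ _).
have lt_d := leq_trans lt_n n_le_d.
have sE : s j.+1 = (s j.+1).-1.+1 by lia.
rewrite sE; apply: (optimal_drop_tight dk hf a0 sa lam0 slam hmu); rewrite -sE //.
rewrite -!nth_v; [|lia|lia].
have -> : v`_(s j.+1) = c j.+2 by apply: value_on_level; rewrite // leqnn.
have -> : v`_(s j.+1).-1 = c j.+1.
  by apply: value_on_level; rewrite // -?/p -?/s; lia.
by apply: level_lt; rewrite // -/p; lia.
Qed.

Lemma value_le_level j i : (j < p)%N -> (s j <= i < n)%N -> v`_i <= c j.+1.
Proof.
move=> jp /andP[ji i_n]; case: (ltnP i (s j.+1)) => [i_lt|].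
  by rewrite (value_on_level n_le v_anti jp) ?ji.
by rewrite leqNgt level_endP // -ltNge; apply: ltW.
Qed.

(** On the last level the common value [c_p] exceeds [lam]; past the support,
    [lam] alone is at least [c_p], by [optimal_support_end_le]. *)
Lemma optimal_flood i : (s p.-1 <= i < d)%N ->
  Num.max (c p) lam`_i = lam`_i + mu`_i.
Proof.
case/andP=> qi id; have on_last r : (s p.-1 <= r < n)%N -> lam`_r + mu`_r = c p.
  move=> /andP[qr rn]; rewrite -nth_v ?(leq_trans rn) // -[in RHS](prednK p_gt0).
  by apply: value_on_level => //; rewrite prednK // -/s qr s_last.
case: (ltnP i n) => ni; first by rewrite on_last ?qi // max_l // -(on_last i) ?qi // lerDl.
have mu_out r : (n <= r)%N -> mu`_r = 0.
  by rewrite leqNgt n_iff -leNgt => mur; apply/eqP; rewrite eq_le mur mu_ge0.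
rewrite mu_out // addr0 max_r //.
have nd : (n < d)%N := leq_ltn_trans ni id.
apply: le_trans (lam_monotone slam ni id).
have -> : c p = lam`_n.-1 + mu`_n.-1 by rewrite on_last //; lia.
have nE : n = n.-1.+1 by lia.
rewrite {3}nE.
by apply: (optimal_support_end_le dk hf a0 sa lam0 slam hmu); rewrite -nE // mu_out.
Qed.

Let sum_flood r : (s p.-1 <= r <= d)%N ->
  \sum_(s p.-1 <= i < r) (Num.max (c p) lam`_i - lam`_i)
    = psum mu r - psum mu (s p.-1).
Proof.
case/andP=> qr rd; rewrite -sum_psum //; apply: eq_big_nat => i /andP[qi ir].
by rewrite optimal_flood ?qi ?(leq_trans ir) // addrC addKr.
Qed.

Let last_start_lt_d : (s p.-1 < d)%N. Proof. exact: leq_trans n_le_d. Qed.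

Let last_tight : psum mu (s p.-1) = psum a (s p.-1).
Proof. by apply: level_end_tight; rewrite prednK. Qed.

(** The mass of [mu] after [s_(p-1)] is that of the truncated [a], so by
    uniqueness of the level the water-filling increment is the tail of [mu]. *)
Lemma last_start_feasible : feasible_index lam a (s p.-1).
Proof.
have [c' [sum_c' ->]] := feasible_index_flood dk last_start_lt_d a0 sa slam.
have eq_max i : (s p.-1 <= i < d)%N -> Num.max c' lam`_i = Num.max (c p) lam`_i.
  apply: (@flood_unique _ (fun i => lam`_i)).
  by rewrite sum_c' sum_flood ?leqnn ?(ltnW last_start_lt_d) // mu_prefix.2 last_tight.
move=> r /andP[qr rd]; rewrite (eq_big_nat _ _ (F2 := fun i => Num.max (c p) lam`_i - lam`_i)).
  by rewrite sum_flood ?qr // last_tight lerD2r mu_prefix.1.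
by move=> i /andP[qi ir]; rewrite eq_max ?qi ?(leq_trans ir).
Qed.

(** Suppose [q < s_(p-1)] is feasible with level [c'].  Feasibility at [s_(p-1)]
    bounds from below the water poured before [s_(p-1)], by the mass of [a]
    there, and thus from above the water poured after it, by the mass of [mu]
    there.  The first bound excludes [c' <= c_p], the second [c' > c_p]. *)
Lemma feasible_ge_last_start q : (q < d)%N -> feasible_index lam a q ->
  (s p.-1 <= q)%N.
Proof.
move=> qd; have [c' [sum_c' ->]] := feasible_index_flood dk qd a0 sa slam.
move=> feas; rewrite leqNgt; apply/negP => q_lt; set e := s p.-1 in q_lt *.
have e_lt_n : (e < n)%N := last_start_lt.
have e_le_d : (e <= d)%N := ltnW last_start_lt_d.
have lam_e : lam`_e < c p.
  rewrite ltNge; apply/negP => cp_le.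
  have := optimal_flood (i := e); rewrite -/e leqnn last_start_lt_d => /(_ isT).
  by rewrite max_r // => /eqP; rewrite lt_eqF // ltrDl -n_iff.
have q_le : (q <= e)%N := ltnW q_lt.
have before_e : psum a e - psum a q
    <= \sum_(q <= i < e) (Num.max c' lam`_i - lam`_i).
  by apply: feas; rewrite q_le.
case: (leP c' (c p)) => [c'_le|c'_gt].
  have p_gt1 : (0 < p.-1)%N.
    by rewrite lt0n; apply: contraTneq q_lt => pE; rewrite /e pE.
  have above i : (i < e)%N -> c p < lam`_i + mu`_i.
    move=> ie; have i_n : (i < n)%N := ltn_trans ie e_lt_n.
    rewrite -nth_v ?(leq_trans i_n) //; apply: (@lt_le_trans _ _ (c p.-1)).
      by apply: level_lt; rewrite // -/p; lia.
    by rewrite -(level_endP n_le v_anti) // -/p; lia.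
  have : \sum_(q <= i < e) (Num.max c' lam`_i - lam`_i) < \sum_(q <= i < e) mu`_i.
    apply: ltr_sum_nat => // i /andP[_ ie].
    rewrite ltrBlDl gt_max (le_lt_trans c'_le) ?above //=.
    apply: (le_lt_trans _ (above _ ie)); apply: le_trans (ltW lam_e).
    by apply: lam_monotone; rewrite // ltnW.
  rewrite sum_psum // last_tight -/e.
  have := mu_prefix.1 q (ltnW qd); lra.
(* The level [c' > c_p] pours at least as much after [s_(p-1)] as [c_p], so the
   bound from above is an equality; but it is strict at [s_(p-1)], where [c_p]
   exceeds [lam]. *)
have flood_e : \sum_(e <= i < d) (Num.max (c p) lam`_i - lam`_i)
    = \sum_(e <= i < d) (Num.max c' lam`_i - lam`_i).
  apply/eqP; rewrite eq_le; apply/andP; split.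
    by apply: ler_sum => i _; rewrite lerD2r ge_max !le_max (ltW c'_gt) lexx orbT.
  have := sum_flood (r := d); rewrite -/e e_le_d leqnn => /(_ isT) ->.
  move: sum_c'; rewrite (big_cat_nat q_le e_le_d) /= mu_prefix.2 last_tight -/e.
  lra.
have e_in : (e <= e < d)%N by rewrite leqnn last_start_lt_d.
have := @flood_le_unique _ (fun i => lam`_i) _ _ _ _ (ltW c'_gt) flood_e e e_in.
by rewrite !max_l ?(ltW lam_e) ?(ltW (lt_trans lam_e c'_gt)) // => /eqP; rewrite lt_eqF.
Qed.

Lemma avg_psum e r : (e < r)%N ->
  avg lam a e.+1 r = (\sum_(e <= i < r) (lam`_i + a`_i)) / (r - e)%:R.
Proof. by move=> er; rewrite /avg big_add1 subnS addn1 prednK // subn_gt0. Qed.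

(** From [s_j] on, partial sums of [lam + a] are those of [lam + mu] minus the
    slack [M_r - A_r], which is nonnegative and vanishes at [s_(j+1)]. *)
Lemma level_is_max_avg j : (j < p.-1)%N ->
  is_maximum
    (fun r => (s j < r <= s p.-1)%N /\
       forall i, (s j < i <= s p.-1)%N -> avg lam a (s j).+1 i <= avg lam a (s j).+1 r)
    (s j.+1)
  /\ c j.+1 = avg lam a (s j).+1 (s j.+1).
Proof.
move=> jp; have jp' : (j < p)%N by lia.
have lt_sj : (s j < s j.+1)%N by exact: level_end_lt.
have le_sj : (s j.+1 <= s p.-1)%N by apply: level_end_mono; rewrite // -/p; lia.
have den r : (s j < r)%N -> 0 < (r - s j)%:R :> R by move=> ?; rewrite ltr0n subn_gt0.
have sumE r : (s j <= r)%N -> \sum_(s j <= i < r) (lam`_i + a`_i)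
    = \sum_(s j <= i < r) (lam`_i + mu`_i) - (psum mu r - psum a r).
  move=> jr; rewrite !big_split /= !sum_psum // level_end_tight //; ring.
have lt_d r : (r <= s p.-1)%N -> (r <= d)%N.
  by move=> /leq_trans; apply; apply: ltnW.
have sum_v r : (r <= s p.-1)%N ->
    \sum_(s j <= i < r) (lam`_i + mu`_i) = \sum_(s j <= i < r) v`_i.
  by move=> rq; apply: eq_big_nat => i /andP[_ ir]; rewrite nth_v // (leq_trans ir) ?lt_d.
have sum_c r : \sum_(s j <= i < r) c j.+1 = c j.+1 * (r - s j)%:R.
  by rewrite sumr_const_nat mulr_natr.
have le_c i : (s j <= i < s p.-1)%N -> v`_i <= c j.+1.
  case/andP=> ji ip; apply: value_le_level => //; rewrite ji.
  exact: ltn_trans last_start_lt.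
have avg_end : avg lam a (s j).+1 (s j.+1) = c j.+1.
  rewrite avg_psum // sumE ?(ltnW lt_sj) // level_end_tight; last by lia.
  rewrite subrr subr0 sum_v // (eq_big_nat _ _ (F2 := fun=> c j.+1)); last first.
    by move=> i ij; apply: value_on_level.
  by rewrite sum_c mulfK // gt_eqF ?den.
have avg_le r : (s j < r <= s p.-1)%N -> avg lam a (s j).+1 r <= c j.+1.
  case/andP=> jr rq; rewrite avg_psum // ler_pdivrMr ?den // -sum_c sumE ?(ltnW jr) //.
  rewrite sum_v // lerBlDr ler_wpDr ?subr_ge0 ?mu_prefix.1 ?lt_d //.
  by apply: ler_sum_nat => i /andP[ji ir]; rewrite le_c // ji (leq_trans ir).
have avg_lt r : (s j.+1 < r <= s p.-1)%N -> avg lam a (s j).+1 r < c j.+1.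
  case/andP=> jr rq; have jr' := ltn_trans lt_sj jr.
  rewrite avg_psum // ltr_pdivrMr ?den // -sum_c sumE ?(ltnW jr') //.
  rewrite sum_v // ltrBlDr ltr_wpDr ?subr_ge0 ?mu_prefix.1 ?lt_d //.
  rewrite !(big_cat_nat (ltnW lt_sj) (ltnW jr)) /= ler_ltD //.
    by apply: ler_sum_nat => i /andP[ji ir]; rewrite le_c // ji (leq_trans ir).
  apply: ltr_sum_nat => // i /andP[ji ir].
  have i_n : (i < n)%N by apply: ltn_trans last_start_lt; exact: leq_trans rq.
  by rewrite ltNge -(level_endP n_le v_anti) // -leqNgt.
split; last by rewrite avg_end.
split; first by rewrite lt_sj le_sj; split=> // i /avg_le; rewrite avg_end.
move=> r [/andP[jr rq] r_max]; rewrite leqNgt; apply/negP => r_gt.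
have := r_max (s j.+1); rewrite lt_sj le_sj avg_end => /(_ isT).
by apply/negP; rewrite -ltNge avg_lt // r_gt.
Qed.

Lemma level_end_lt_inv j : (j <= p)%N -> (s j < s p.-1)%N -> (j < p.-1)%N.
Proof.
move=> jp; apply: contraTT; rewrite -!leqNgt => pj.
by apply: level_end_mono; rewrite // pj.
Qed.

Lemma last_start_is_min_feasible :
  is_minimum (fun q => (q < d)%N /\ feasible_index lam a q) (s p.-1).
Proof.
split; first by split; [exact: last_start_lt_d | exact: last_start_feasible].
by move=> q [qd]; apply: feasible_ge_last_start.
Qed.

End OptimalStructure.

Theorem proposition4p6 (R : realType) (d k n0 : nat)
    (F0 : 'I_n0 -> 'cV[R[i]]_d) (a : k.-tuple R)
    (lam mu : d.-tuple R) (f : R -> R)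
    (hd : (0 < d)%N) (hdk : (d <= k)%N)
    (hdata : initial_data F0 a)
    (hlam : eigenvalues_increasing (frame_operator F0) lam)
    (hf0 : forall x : R, 0 <= x -> 0 <= f x)
    (hf : strictly_convex_nneg f)
    (hmu : is_mu f lam a mu) :
  let p : nat := size (levels lam mu) in
  let c : nat -> R := entry (levels lam mu) in
  let s : nat -> nat := level_end lam mu in
  let P : nat -> nat -> R := avg lam a in
  is_minimum (fun q : nat => (q < d)%N /\ feasible_index lam a q) (s p.-1)
  /\
  ((1 < p)%N ->
    (is_maximum
       (fun j : nat =>
          (1 <= j <= s p.-1)%N /\
          forall i : nat, (1 <= i <= s p.-1)%N -> P 1%N i <= P 1%N j)
       (s 1%N)
     /\ c 1%N = P 1%N (s 1%N))
    /\
    (forall j : nat, (1 <= j <= p)%N -> (s j < s p.-1)%N ->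
       is_maximum
         (fun r : nat =>
            (s j < r <= s p.-1)%N /\
            forall i : nat, (s j < i <= s p.-1)%N ->
              P (s j).+1 i <= P (s j).+1 r)
         (s j.+1)
       /\ c j.+1 = P (s j).+1 (s j.+1))).
Proof.
have [a0 sa _] := hdata; have [slam _] := hlam.
have lam0 := eigenvalues_increasing_ge0 hlam.
move=> p c s P.
have step j := @level_is_max_avg R d k f lam mu a hd hdk hf a0 sa lam0 slam hmu j.
split; first exact: (last_start_is_min_feasible hd hdk hf a0 sa lam0 slam hmu).
move=> p_gt1; split.
  by apply: (step 0%N); rewrite -/p; lia.
move=> j /andP[_ jp] sj_lt; apply: (step j).
exact: (level_end_lt_inv hdk hf a0 sa lam0 slam hmu).
Qed.
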